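(* For each nonnegative integer $m$, the coefficient of $t^m$ in $$F(t,s;u)=1+\sum_{n\geq 2}\Bigl(\sum_{\pi\in\mathcal{D}_n}t^{\mathrm{des}(\pi)}s^{\mathrm{xdes}(\pi)}\Bigr)u^n$$ is a rational fraction in $s$ and $u$.
   Context: $\mathcal{D}_n$ denotes the set of derangements of $[n]=\{1,\dots,n\}$ (permutations without fixed points). For a permutation $\pi=\pi_1\cdots\pi_n$, $\mathrm{des}(\pi)=|\{i\in[n-1]:\pi_i>\pi_{i+1}\}|$, and an index $i$ is a crossing descent if $\pi_i\ge i+1\ge\pi_{i+1}$; $\mathrm{xdes}(\pi)$ is the number of crossing descents of $\pi$. *)

(* Defs.v *)
From HB Require Import structures.
From mathcomp Require Import all_boot all_order all_algebra all_fingroup.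
Set Implicit Arguments. Unset Strict Implicit. Unset Printing Implicit Defensive.
Import GRing.Theory.
Local Open Scope ring_scope.

(* Permutations of [n] are modelled as {perm 'I_n}, with 0-based positions
   and values: the one-line word is pw p = [:: p 0; ...; p (n-1)] (as nats). *)
Definition pw n (p : {perm 'I_n}) : seq nat := [seq val (p i) | i <- enum 'I_n].

Definition derangement n (p : {perm 'I_n}) : bool := [forall i, p i != i].

Definition des n (p : {perm 'I_n}) : nat :=
  count (fun k => nth 0%N (pw p) k.+1 < nth 0%N (pw p) k)%N (iota 0 n.-1).

(* xdes: 1-based index i in [n-1] is a crossing descent iff pi_i >= i+1 >= pi_{i+1}.
   With 0-based k = i-1 and 0-based values v = pi - 1 this reads
   v_k >= k+1 and v_{k+1} <= k. *)
Definition xdes n (p : {perm 'I_n}) : nat :=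
  count (fun k => (k < nth 0%N (pw p) k) && (nth 0%N (pw p) k.+1 <= k))%N
        (iota 0 n.-1).

(* Coefficient of t^m u^n in F(t,s;u), as a polynomial in s over Q. *)
Definition Fcoef (m n : nat) : {poly rat} :=
  if n == 0%N then (m == 0%N)%:R
  else if n == 1%N then 0
  else \sum_(p : {perm 'I_n} | derangement p && (des p == m)) 'X^(xdes p).

(* A power series sum_n a n u^n with coefficients in Q[s] is a rational fraction
   in s and u: there are polynomials P, Q in Q[s][u], Q <> 0, with Q * A = P
   as formal power series in u. *)
Definition rational_series (a : nat -> {poly rat}) : Prop :=
  exists (P Q : {poly {poly rat}}), Q != 0 /\
    forall n : nat, \sum_(k < n.+1) Q`_k * a (n - k)%N = P`_n.

(* Main.v *)
(**
  Split a derangement into increasing blocks on which the sign of pi_i - i is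
  constant, allowing extra cuts.  If b_i is the block of position i, the word
  w = b o pi^-1 is a rearrangement of b and determines pi; the sign conditions
  become a condition on the pairs (b_v, w_v), strengthened at one position of
  each block in order to exclude fixed points.

  Pairs (b, w) with b sorted, w a rearrangement of b and A b_v w_v for all v are
  counted as in MacMahon's master theorem: read w on block i as a stack of
  outgoing arcs of the vertex i, and walk from a vertex r by popping the stacks.
  The walk must end at r with the stack of r empty, leaving a smaller
  configuration without r.  Popping one arc gives a linear system
  F = u A F + e_r T', so rationality follows by induction on the set of vertices.
  Forbidding a fixed point in a block multiplies the series by 1 - u.

  Finally a derangement of [n] with c compulsory cuts has C(n-1-c, K-1-c)
  divisions into K blocks.  This triangular relation is inverted by induction on
  the number of descents; the binomials are polynomial in n, and multiplying the
  coefficients by n preserves rationality.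
*)
Require Import Defs.
From mathcomp Require Import all_boot all_order all_algebra all_fingroup.
From mathcomp Require Import zify ring.
Set Implicit Arguments. Unset Strict Implicit. Unset Printing Implicit Defensive.
Import GRing.Theory.
Local Open Scope ring_scope.

(** * Rational power series *)

Section RationalSeries.
Variable R : idomainType.

Definition is_rational (a : nat -> R) : Prop :=
  exists (P Q : {poly R}), Q != 0 /\
    forall n : nat, \sum_(k < n.+1) Q`_k * a (n - k)%N = P`_n.

Definition trunc (a : nat -> R) N : {poly R} := \poly_(i < N.+1) a i.

(** Congruence modulo ['X^(N.+1)]: with [trunc], identities of power series become identities of
    polynomials. *)
Definition eqX N (p q : {poly R}) := forall n, (n <= N)%N -> p`_n = q`_n.

Lemma eqX_refl N p : eqX N p p. Proof. by []. Qed.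

Lemma eqX_trans N p q r : eqX N p q -> eqX N q r -> eqX N p r.
Proof. by move=> pq qr n le_nN; rewrite pq ?qr. Qed.

Lemma eqXD N p p' q q' : eqX N p q -> eqX N p' q' -> eqX N (p + p') (q + q').
Proof. by move=> pq pq' n le_nN; rewrite !coefD pq ?pq'. Qed.

Lemma eqXM N p p' q q' : eqX N p q -> eqX N p' q' -> eqX N (p * p') (q * q').
Proof.
move=> pq pq' n le_nN; rewrite !coefM; apply: eq_bigr => i _.
by rewrite pq ?pq' // (leq_trans _ le_nN) ?leq_subr // -ltnS.
Qed.

Lemma eqX_sum N (I : finType) (F G : I -> {poly R}) :
  (forall i, eqX N (F i) (G i)) -> eqX N (\sum_i F i) (\sum_i G i).
Proof. by move=> FG n le_nN; rewrite !coef_sum; apply: eq_bigr => i _; exact: FG. Qed.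

Lemma is_rationalP a : is_rational a <->
  exists P Q, Q != 0 /\ forall N, eqX N (Q * trunc a N) P.
Proof.
split=> -[P [Q [Q0 QP]]]; exists P, Q; split=> //.
  move=> N n le_nN; rewrite -QP coefM; apply: eq_bigr => k _.
  by rewrite coef_poly ltnS (leq_trans (leq_subr _ _) le_nN).
move=> n; rewrite -(QP n n (leqnn n)) coefM; apply: eq_bigr => k _.
by rewrite coef_poly ltnS leq_subr.
Qed.

Lemma eq_is_rational a b : a =1 b -> is_rational a -> is_rational b.
Proof.
move=> ab [P [Q [Q0 QP]]]; exists P, Q; split=> // n.
by rewrite -QP; apply: eq_bigr => k _; rewrite ab.
Qed.

Lemma is_rationalD a b : is_rational a -> is_rational b ->
  is_rational (fun n => a n + b n).
Proof.
move=> /is_rationalP[P [Q [Q0 QP]]] /is_rationalP[P' [Q' [Q'0 QP']]].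
apply/is_rationalP; exists (Q' * P + Q * P'), (Q' * Q).
split=> [|N]; first by rewrite mulf_neq0.
have ->: trunc (fun n => a n + b n) N = trunc a N + trunc b N.
  by apply/polyP=> i; rewrite coefD !coef_poly; case: ifP => // _; rewrite addr0.
rewrite mulrDr; apply: eqXD; first by rewrite -mulrA; apply: eqXM.
by rewrite [Q' * Q]mulrC -mulrA; apply: eqXM.
Qed.

Lemma is_rationalZ c a : is_rational a ->
  is_rational (fun n => c * a n).
Proof.
move=> [P [Q [Q0 QP]]]; exists (c%:P * P), Q; split=> // n.
by rewrite coefCM -QP mulr_sumr; apply: eq_bigr => k _; rewrite mulrCA.
Qed.

Lemma is_rationalB a b : is_rational a -> is_rational b ->
  is_rational (fun n => a n - b n).
Proof.
move=> ra /(is_rationalZ (-1)) rb.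
by apply: eq_is_rational (is_rationalD ra rb) => n; rewrite mulN1r.
Qed.

Lemma is_rational0 : is_rational (fun=> 0).
Proof.
exists 0, 1; split=> [|n]; first exact: oner_neq0.
by rewrite coef0 big1 // => k _; rewrite mulr0.
Qed.

Lemma is_rational_sum (I : Type) (s : seq I) (P : pred I) (F : I -> nat -> R) :
  (forall i, P i -> is_rational (F i)) ->
  is_rational (fun n => \sum_(i <- s | P i) F i n).
Proof.
move=> rF; elim: s => [|i s IHs].
  by apply: eq_is_rational is_rational0 => n; rewrite big_nil.
case Pi: (P i); last by apply: eq_is_rational IHs => n; rewrite big_cons Pi.
apply: eq_is_rational (is_rationalD (rF i Pi) IHs) => n.
by rewrite big_cons Pi.
Qed.

Lemma is_rational_from N a b : (forall n, (N <= n)%N -> a n = b n) ->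
  is_rational a -> is_rational b.
Proof.
move=> ab ra.
suff rd: is_rational (fun n => b n - a n).
  by apply: eq_is_rational (is_rationalD ra rd) => n; rewrite addrC subrK.
exists (\poly_(i < N) (b i - a i)), 1; split=> [|n]; first exact: oner_neq0.
rewrite big_ord_recl /= coef1 mul1r subn0 big1 ?addr0 => [|k _].
  by rewrite coef_poly; case: ltnP => // le_Nn; rewrite ab // subrr.
by rewrite coef1 mul0r.
Qed.

Lemma is_rational_shift a : is_rational a ->
  is_rational (fun n => if n is n'.+1 then a n' else 0).
Proof.
move=> [P [Q [Q0 QP]]]; exists ('X * P), Q; split=> // n.
rewrite big_ord_recr /= subnn mulr0 addr0 coefXM; case: n => [|n] /=.
  by rewrite big_ord0.
by rewrite -QP; apply: eq_bigr => k _; rewrite subSn // -ltnS.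
Qed.

(** Differentiating [Q A = P] gives [Q^2 u A' = Q u P' - u Q' P]. *)
Lemma is_rational_natmul a : is_rational a ->
  is_rational (fun n => n%:R * a n).
Proof.
move=> /is_rationalP[P [Q [Q0 QP]]]; apply/is_rationalP.
exists (Q * ('X * P^`()) - 'X * Q^`() * P), (Q * Q).
split=> [|N]; first by rewrite mulf_neq0.
have coefXD (p : {poly R}) n : ('X * p^`())`_n = n%:R * p`_n.
  by rewrite coefXM; case: n => [|n]; rewrite ?mul0r // coef_deriv /= mulr_natl.
have ->: trunc (fun n => n%:R * a n) N = 'X * (trunc a N)^`().
  apply/polyP=> i; rewrite coefXD !coef_poly.
  by case: ifP => // _; rewrite mulr0.
have ->: Q * Q * ('X * (trunc a N)^`()) =
         Q * ('X * (Q * trunc a N)^`()) - 'X * Q^`() * (Q * trunc a N).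
  by rewrite derivM; ring.
apply: eqXD.
  by apply: eqXM => // n le_nN; rewrite !coefXD QP.
by move=> n le_nN; rewrite !coefN; congr (- _); apply: (@eqXM N).
Qed.

Lemma is_rational_cancel c a : c != 0 -> is_rational (fun n => c * a n) ->
  is_rational a.
Proof.
move=> c0 [P [Q [Q0 QP]]]; exists P, (c%:P * Q); split=> [|n].
  by rewrite mulf_neq0 ?polyC_eq0.
by rewrite -QP; apply: eq_bigr => k _; rewrite coefCM mulrCA mulrA.
Qed.

(** Induction on [k] from [(k+1) C(x, k+1) = (x - k) C(x, k)] with [x = n-1-c], so that
    [x - k = n - (1+c+k)]. The vanishing of [a] up to [c] covers the indices where the truncated
    [n.-1 - c] differs from [x]. *)
Lemma is_rational_bin a c k : (forall j, j.+1%:R != 0 :> R) ->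
  (forall n, (n <= c)%N -> a n = 0) ->
  is_rational a -> is_rational (fun n => 'C(n.-1 - c, k)%:R * a n).
Proof.
move=> char0 a0 ra; elim: k => [|k IHk].
  by apply: eq_is_rational ra => n; rewrite bin0 mul1r.
apply: (is_rational_cancel (char0 k)).
have := is_rationalB (is_rational_natmul IHk) (is_rationalZ (1 + c + k)%:R IHk).
apply: eq_is_rational => n.
case: (leqP n c) => [le_nc | lt_cn]; first by rewrite a0 // !(mulr0, subr0).
case: n lt_cn => // n lt_cn; rewrite succnK -mulrBl !mulrA; congr (_ * _).
rewrite -natrM mul_bin_left.
(* Below [k] the truncated difference disagrees with the one in [R], but both multiply a zero
   binomial. *)
have [lt_k | le_k] := ltnP (n - c) k.
  by rewrite bin_small // muln0 mulr0.
rewrite natrM natrB //; congr (_ * _).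
have -> : n.+1 = (1 + c + (n - c))%N by lia.
rewrite (natrD _ (1 + c) k) (natrD _ (1 + c) (n - c)).
by rewrite opprD addrACA subrr add0r.
Qed.

(** In generating functions the recursion reads [(1 - u M) F = G e_r]; Cramer's rule gives [F_i =
    adj(1 - u M)_(i,r) G / det(1 - u M)]. *)
Lemma is_rational_linear K (M : 'M[R]_K) (r : 'I_K) (f : 'I_K -> nat -> R) g :
  is_rational g ->
  (forall i, f i 0%N = (i == r)%:R * g 0%N) ->
  (forall i n, f i n.+1 = \sum_j M i j * f j n + (i == r)%:R * g n.+1) ->
  forall i, is_rational (f i).
Proof.
move=> /is_rationalP[P [Q [Q0 QP]]] f0 fS i; apply/is_rationalP.
pose D : 'M[{poly R}]_K := 1%:M - 'X *: map_mx polyC M.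
(* At [u = 0] the matrix [D] is the identity. *)
have D0: \det D != 0.
  apply/eqP => /(congr1 (horner^~ 0)); rewrite -[LHS]/(horner_eval 0 _).
  rewrite -det_map_mx horner0 (_ : map_mx _ _ = 1%:M) ?det1 => [/eqP|].
    by rewrite oner_eq0.
  apply/matrixP=> k j; rewrite !mxE rmorphB rmorphM rmorph_nat /= /horner_eval hornerX.
  by rewrite mul0r subr0.
exists (\adj D i r * P), (Q * \det D); split=> [|N]; first by rewrite mulf_neq0.
have Df k : eqX N (\sum_j D k j * trunc (f j) N) ((k == r)%:R * trunc g N).
  move=> n le_nN; rewrite coef_sum.
  under eq_bigr => j _ do rewrite !mxE mulrBl coefB -mulrA coefXM coefCM.
  rewrite big_split /= sumrN -coef_sum (bigD1 k) //= big1 => [|j /negPf nkj].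
    rewrite eqxx mulr1n mul1r addr0 -[(k == r)%:R]/((k == r)%:R : {poly R}) .
    rewrite mulr_natl coefMn !coef_poly ltnS le_nN.
    case: n le_nN => [|n] le_nN.
      by rewrite big1 // subr0 f0 mulr_natl.
    rewrite fS addrC mulr_natl (eq_bigr (fun j => M k j * f j n)) ?addKr //.
    by move=> j _; rewrite coef_poly ltnS ltnW.
  by rewrite eq_sym nkj mul0r.
have dF: eqX N (\det D * trunc (f i) N) (\adj D i r * trunc g N).
  have ->: \det D * trunc (f i) N =
           \sum_k \adj D i k * (\sum_j D k j * trunc (f j) N).
    transitivity ((\adj D *m (D *m \col_j trunc (f j) N)) i 0).
      by rewrite mulmxA mul_adj_mx mul_scalar_mx !mxE.
    rewrite [LHS]mxE; apply: eq_bigr => k _; congr (_ * _); rewrite [LHS]mxE.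
    by apply: eq_bigr => j _; rewrite [X in _ * X = _]mxE.
  apply: (eqX_trans (eqX_sum (fun k => eqXM (@eqX_refl N (\adj D i k)) (Df k)))).
  rewrite (bigD1 r) //= eqxx mul1r big1 ?addr0 // => k /negPf->.
  by rewrite mul0r mulr0.
rewrite -mulrA; apply: (eqX_trans (eqXM (@eqX_refl N Q) dF)).
by rewrite mulrCA; apply: eqXM.
Qed.

End RationalSeries.

(** * Words and closed walks *)

Section Words.
Variable K : nat.
Implicit Types (i j r : 'I_K) (C D S : {set 'I_K}) (b d : seq 'I_K).
Local Open Scope nat_scope.

Definition ord_le i j := i <= j.

Lemma ord_le_total : total ord_le. Proof. by move=> i j; exact: leq_total. Qed.
Lemma ord_le_trans : transitive ord_le. Proof. by move=> i j k; exact: leq_trans. Qed.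
Lemma ord_le_anti : antisymmetric ord_le.
Proof. by move=> i j ?; apply/val_inj/anti_leq. Qed.

(* The letters [e] are read before the word [w] itself. *)
Definition words (X : Type) (B : X -> pred 'I_K) n (x : seq X) (e d : seq 'I_K) :=
  \sum_(w : n.-tuple 'I_K | perm_eq (e ++ w) d && all2 B x w) 1.

Lemma words_permr X (B : X -> pred 'I_K) n x e d d' :
  perm_eq d d' -> words B n x e d = words B n x e d'.
Proof. by move=> /permPr dd'; apply: eq_bigl => w; rewrite dd'. Qed.

Lemma words_cat X (B : X -> pred 'I_K) n x e d : words B n x e (e ++ d) = words B n x [::] d.
Proof. by apply: eq_bigl => w; rewrite perm_cat2l. Qed.

Lemma words_map X Y (f : X -> Y) (B : Y -> pred 'I_K) n x e d :
  words B n (map f x) e d = words (B \o f) n x e d.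
Proof.
apply: eq_bigl => w; congr (_ && _).
by elim: x (val w) => [|x0 x IHx] [|j s] //=; rewrite IHx.
Qed.

Lemma words_cons X (B : X -> pred 'I_K) n x0 x e d :
  words B n.+1 (x0 :: x) e d = \sum_(j | B x0 j) words B n x (rcons e j) d.
Proof.
rewrite pair_big_dep /= /words.
rewrite (reindex (fun jw : 'I_K * n.-tuple 'I_K => [tuple of jw.1 :: jw.2])) /=.
  by apply: eq_bigl => -[j w] /=; rewrite cat_rcons andbCA.
exists (fun w => (thead w, [tuple of behead w])) => [[j w] _ | w _] /=.
  by congr (_, _); apply: val_inj.
by rewrite [RHS]tuple_eta; apply: val_inj.
Qed.

Lemma all2_tuple X Y (B : X -> pred Y) n (t : n.-tuple X) (w : n.-tuple Y) :
  all2 B t w = [forall i, B (tnth t i) (tnth w i)].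
Proof.
rewrite all2E !size_tuple eqxx /=.
rewrite -[zip t w]/(val [tuple of zip t w]).
have tnth_zip (k : 'I_n) : tnth [tuple of zip t w] k = (tnth t k, tnth w k).
  rewrite (tnth_nth (tnth t k, tnth w k)) /= nth_zip ?size_tuple //.
  by rewrite -!tnth_nth.
by apply/all_tnthP/forallP => Btw i; have := Btw i; rewrite tnth_zip.
Qed.

(** Permuting the letters of [w] along with the rows preserves both conditions on [w]. *)
Lemma words_perml (X : eqType) (B : X -> pred 'I_K) n x x' e d :
  perm_eq x x' -> words B n x e d = words B n x' e d.
Proof.
move=> xx'; have sz_x := perm_size xx'.
have [sx|sx] := eqVneq (size x) n; last first.
  rewrite /words !big_pred0 // => w; rewrite all2E size_tuple.
    by rewrite -sz_x (negPf sx) andbF.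
  by rewrite (negPf sx) andbF.
have sx': size x' == n by rewrite -sz_x sx.
move/eqP in sx; move: xx'; rewrite -[x]/(val (Tuple sx)) -[x']/(val (Tuple sx')).
move: (Tuple sx) (Tuple sx') => {sx sx' sz_x x x'} t t'.
rewrite perm_sym => /tuple_permP[p t'E].
pose h (w : n.-tuple 'I_K) := [tuple tnth w (p i) | i < n].
rewrite /words [RHS](reindex_inj (h := h)) /=; last first.
  move=> w1 w2 e12; apply: eq_from_tnth => i.
  by have := congr1 (fun t => tnth t (p^-1 i)%g) e12; rewrite !tnth_mktuple permKV.
apply: eq_bigl => w.
have /permPl->: perm_eq (e ++ h w) (e ++ w).
  by rewrite perm_cat2l; apply/tuple_permP; exists p.
congr (_ && _); rewrite t'E (all2_tuple B [tuple tnth t (p i) | i < n] (h w)) all2_tuple.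
apply/forallP/forallP => Bw k; first by rewrite !tnth_mktuple.
by have := Bw (p^-1 k)%g; rewrite !tnth_mktuple permKV.
Qed.

(** The row [x1] forbids just the letter [j]; deleting the first row from the words that use [j]
    there leaves arbitrary words on the remaining rows. *)
Lemma words_mark X (B : X -> pred 'I_K) n x0 x1 x j d :
  (forall l, B x1 l = B x0 l && (l != j)) -> B x0 j ->
  words B n.+1 (x1 :: x) [::] (j :: d) + words B n x [::] d =
  words B n.+1 (x0 :: x) [::] (j :: d).
Proof.
move=> B1 B0; rewrite !words_cons (bigD1 (P := B x0) j) //= addnC.
rewrite -(words_cat _ _ _ [:: j]); congr (_ + _).
exact: eq_bigl.
Qed.

(** A sorted word stands for a multiset, so this is a sum over multisets of size [n] with support in
    [C]. *)
Definition sum_sorted C n (F : seq 'I_K -> nat) :=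
  \sum_(b : n.-tuple 'I_K | sorted ord_le b && all (mem C) b) F b.

Lemma sum_sorted0 C F : sum_sorted C 0 F = F [::].
Proof.
rewrite /sum_sorted (big_pred1 [tuple]) // => b.
by rewrite [b]tuple0 /= eqxx.
Qed.

Lemma eq_sum_sorted C n F G :
  (forall b, size b = n -> all (mem C) b -> F b = G b) ->
  sum_sorted C n F = sum_sorted C n G.
Proof.
by move=> FG; apply: eq_bigr => b /andP[_ bC]; apply: FG; rewrite ?size_tuple.
Qed.

(** A multiset either contains [i], and is [i] added to a smaller one, or avoids [i]. *)
Lemma sum_sortedS C n F i : i \in C -> (forall b b', perm_eq b b' -> F b = F b') ->
  sum_sorted C n.+1 F =
  sum_sorted C n (fun b => F (i :: b)) + sum_sorted (C :\ i) n.+1 F.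
Proof.
move=> iC Fperm; rewrite /sum_sorted.
rewrite (bigID (fun b : n.+1.-tuple 'I_K => i \in b)) /=; congr (_ + _); last first.
  apply: eq_bigl => b; rewrite -andbA; congr (_ && _).
  apply/andP/allP => [[/allP bC ib] j jb | bC].
    by apply/setD1P; split; [apply: contraNneq ib => <- | exact: bC].
  split; first by apply/allP=> j /bC/setD1P[].
  by apply/negP => /bC/setD1P[/eqP].
(* Insertion and removal of one [i]. The default of [insubd] is returned only for words without [i],
   which lie outside the sum. *)
pose h (b : n.-tuple 'I_K) : n.+1.-tuple 'I_K := [tuple of sort ord_le (i :: b)].
pose h' (b : n.+1.-tuple 'I_K) := insubd (nseq_tuple n i) (rem i b).
have h'E (b : n.+1.-tuple 'I_K) : i \in b -> val (h' b) = rem i b.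
  by move=> ib; rewrite insubdK // -topredE /= size_rem // size_tuple.
have hperm (b : n.-tuple 'I_K) : perm_eq (h b) (i :: b) by rewrite /h /= perm_sort.
rewrite (reindex_onto h h') /=; last first.
  move=> b /andP[/andP[sb _] ib]; apply: val_inj => /=.
  apply: (sorted_eq ord_le_trans ord_le_anti) => //.
    exact: sort_sorted ord_le_total _.
  by rewrite perm_sort h'E // perm_sym perm_to_rem.
apply: eq_big => [b | b _]; last exact: (Fperm _ _ (hperm b)).
rewrite (perm_mem (hperm b)) mem_head andbT.
rewrite (perm_all _ (hperm b)) /= (sort_sorted ord_le_total) iC /=.
have ihb : i \in h b by rewrite (perm_mem (hperm b)) mem_head.
have hb : perm_eq (rem i (h b)) b.
  by rewrite -(perm_cons i) -(permPr (hperm b)) perm_sym perm_to_rem.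
apply/andP/andP => -[].
  move=> bC /eqP<-; split; last by rewrite h'E // (perm_all _ hb).
  rewrite h'E //; apply: (subseq_sorted ord_le_trans (rem_subseq _ _)).
  exact: sort_sorted ord_le_total _.
move=> sb bC; split=> //; apply/eqP/val_inj; rewrite h'E //.
apply: (sorted_eq ord_le_trans ord_le_anti) => //.
apply: (subseq_sorted ord_le_trans (rem_subseq _ _)).
exact: sort_sorted ord_le_total _.
Qed.

(* The stacks are given by the rows [b]; a walk from [r], now at [i], still has to
   enter each vertex as often as it occurs in [b], plus once at [r], minus once
   at [i]. *)
Definition walks (A : 'I_K -> pred 'I_K) C r i n :=
  sum_sorted C n (fun b => words A n b [:: i] (r :: b)).

(** If [b] contains [i], a row [i] can be put first: its letter [j] is the popped arc, and the [i]
    already read cancels against the removed row. If [b] avoids [i], then [i] must be the extra [r],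
    the walk is over, and a configuration without [r] remains. *)
Lemma walksS A C r i n : i \in C -> walks A C r i n.+1 =
  \sum_(j | A i j) walks A C r j n + (i == r) * walks A (C :\ r) r r n.+1.
Proof.
move=> iC; rewrite /walks (sum_sortedS _ iC) => [|b b' bb']; last first.
  by rewrite (words_perml _ _ _ _ bb'); apply: words_permr; rewrite perm_cons.
congr (_ + _).
  rewrite /sum_sorted exchange_big; apply: eq_bigr => b _ /=.
  rewrite words_cons; apply: eq_bigr => j _ /=.
  rewrite (@words_permr _ _ _ _ _ _ ([:: i] ++ (r :: b))); last first.
    by rewrite (perm_catCA [:: r] [:: i]).
  by apply: eq_bigl => w; rewrite perm_cons.
have [<-|ir] := eqVneq i r; first by rewrite mul1n.
rewrite mul0n /sum_sorted big1 // => b /andP[_ /allP bC].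
rewrite /words big_pred0 // => w; apply/negP => /andP[/perm_mem/(_ i)].
rewrite !inE eqxx (negPf ir) /= => /esym/bC.
by rewrite !inE eqxx.
Qed.

(* One row of each block in [S] is marked; [words_perml] makes its position
   irrelevant for counting. *)
Fixpoint marks S (b : seq 'I_K) : seq ('I_K * bool) :=
  if b is j :: b' then (j, (j \in S) && (j \notin b')) :: marks S b' else [::].

Lemma map_marks S b : map fst (marks S b) = b.
Proof. by elim: b => //= j b IHb; rewrite IHb. Qed.

Lemma count_marks S b j :
  count_mem (j, true) (marks S b) = (j \in S) && (j \in b).
Proof.
elim: b => [|k b IHb] /=; first by rewrite andbF.
rewrite IHb in_cons xpair_eqE eqb_id [j == k]eq_sym.
by have [->|] := eqVneq k j => //=; case: (j \in S); case: (j \in b).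
Qed.

(** The multiplicity of [(j, false)] is that of [j] minus that of [(j, true)]. *)
Lemma perm_marked (x y : seq ('I_K * bool)) :
  perm_eq (map fst x) (map fst y) ->
  (forall j, count_mem (j, true) x = count_mem (j, true) y) -> perm_eq x y.
Proof.
move=> /seq.permP xy cxy; apply/allP => -[j []] _ /=; first by rewrite cxy.
have split_count z : count_mem j (map fst z) =
    count_mem (j, true) z + count_mem (j, false) z.
  elim: z => //= -[k []] z /= ->; rewrite !xpair_eqE /= ?andbT ?andbF.
    by rewrite addnA.
  by rewrite addnCA.
have := xy (pred1 j); rewrite !split_count cxy => /addnI->.
exact: eqxx.
Qed.

Lemma perm_marks S b b' : perm_eq b b' -> perm_eq (marks S b) (marks S b').
Proof.
move=> bb'; apply: perm_marked => [|j]; first by rewrite !map_marks.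
by rewrite !count_marks (perm_mem bb').
Qed.

Definition closed_words (B : 'I_K * bool -> pred 'I_K) S C n :=
  sum_sorted C n (fun b => words B n (marks S b) [::] b).

(** This is the factor [1 - u]. Multisets without [j] contribute equally with and without the mark;
    on the others [words_mark] applies to one row of the block [j]. *)
Lemma closed_words_mark B S C j n :
  (forall l, B (j, true) l = B (j, false) l && (l != j)) -> B (j, false) j ->
  j \in C -> j \notin S ->
  closed_words B (j |: S) C n.+1 + closed_words B S C n = closed_words B S C n.+1.
Proof.
move=> Bt Bf jC jS; rewrite /closed_words.
have inv S' b b' : perm_eq b b' ->
    words B n.+1 (marks S' b) [::] b = words B n.+1 (marks S' b') [::] b'.
  by move=> bb'; rewrite (words_permr _ _ _ _ bb') (words_perml _ _ _ _ (perm_marks _ bb')).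
rewrite !(sum_sortedS _ jC (inv _)).
rewrite addnAC; congr (_ + _); last first.
  apply: eq_sum_sorted => b _ /allP bC.
  have jb : j \notin b by apply/negP => /bC/setD1P[/eqP].
  apply: words_perml; apply: perm_marked => [|k]; first by rewrite !map_marks.
  rewrite !count_marks !inE; have [->|] := eqVneq k j => //=.
  by rewrite (negPf jb) andbF.
rewrite /sum_sorted -big_split; apply: eq_bigr => b _.
have /(words_perml B)-> : perm_eq (marks S (j :: b)) ((j, false) :: marks S b).
  apply: perm_marked => [|k]; first by rewrite /= !map_marks.
  by rewrite /= !count_marks (negPf jS) xpair_eqE eqb_id andbF.
rewrite -(words_mark _ _ _ Bt Bf); congr (_ + _).
apply: words_perml; apply: perm_marked => [|k]; first by rewrite /= !map_marks.
rewrite /= !count_marks !inE; have [->|kj] := eqVneq k j.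
  by rewrite !xpair_eqE !eqxx (negPf jS) /= eqb_id; case: (j \in b).
by rewrite !xpair_eqE [j == k]eq_sym (negPf kj).
Qed.

Lemma closed_words_unmarked B S C j n : j \notin C ->
  closed_words B (j |: S) C n = closed_words B S C n.
Proof.
move=> jC; apply: eq_sum_sorted => b _ /allP bC.
have jb : j \notin b by apply: contra jC => /bC.
apply: words_perml; apply: perm_marked => [|k]; first by rewrite !map_marks.
rewrite !count_marks !inE; have [->|] := eqVneq k j => //=.
by rewrite (negPf jb) andbF.
Qed.

End Words.

(** * Rationality of the word series *)

Section RationalWords.
Variables (R : idomainType) (K : nat).
Implicit Types (C D S : {set 'I_K}) (B : 'I_K * bool -> pred 'I_K).

(** Induction on [#|C|]. For [r] in [C] the walks from all vertices satisfy the linear system of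
    [walksS], whose inhomogeneous term lives on [C :\ r]; the walks from [r] itself are the words
    wanted. *)
Lemma is_rational_sum_sorted (A : 'I_K -> pred 'I_K) C :
  is_rational (fun n => (sum_sorted C n (fun b => words A n b [::] b))%:R : R).
Proof.
have walksE D r n :
    sum_sorted D n (fun b => words A n b [::] b) = walks A D r r n.
  by apply: eq_sum_sorted => b _ _; rewrite -(words_cat _ _ _ [:: r]).
move: {2}#|C| (leqnn #|C|) => c; elim: c C => [|c IHc] C.
  rewrite leqn0 cards_eq0 => /eqP->.
  apply: (is_rational_from (N := 1)) (is_rational0 R) => -[] // n _.
  rewrite /sum_sorted big_pred0 // => -[[|j b] sz_b] //=.
  by rewrite inE andbF.
have [-> _ | [r rC] leC] := set_0Vmem C; first by apply: IHc; rewrite cards0.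
have /IHc ratD : (#|C :\ r| <= c)%N by rewrite -ltnS (leq_trans _ leC) // (cardsD1 r C) rC.
(* Outside [C] there is no walk, since [i] would have to occur in [r :: b]; hence the zero rows of
   [M] below. *)
have notinC i n : i \notin C -> walks A C r i n = 0%N.
  move=> iC; rewrite /walks /sum_sorted big1 // => b /andP[_ /allP bC].
  rewrite /words big_pred0 // => w; apply/negP => /andP[/perm_mem/(_ i)].
  rewrite !inE eqxx /= => /esym/predU1P[ir | /bC /= iC'].
    by rewrite ir rC in iC.
  by rewrite iC' in iC.
pose M := \matrix_(i, j) ((i \in C) && A i j)%:R : 'M[R]_K.
have walks0 i : walks A C r i 0 = (i == r).
  rewrite /walks sum_sorted0 /words.
  have [->|ir] := eqVneq i r.
    by rewrite (big_pred1 [tuple]) // => w; rewrite [w]tuple0 /= perm_refl eqxx.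
  rewrite big_pred0 // => w; rewrite [w]tuple0 /= andbT.
  by apply/negP => /perm_mem/(_ i); rewrite !inE eqxx (negPf ir).
have := @is_rational_linear R K M r (fun i n => (walks A C r i n)%:R) _ ratD.
move=> /(_ _ _ r)-rat; apply: (eq_is_rational (fun n => esym (congr1 _ (walksE C r n)))).
apply: rat => [i | i n].
  rewrite walks0 /= sum_sorted0 /words (big_pred1 [tuple]) ?mulr1 // => w.
  by rewrite [w]tuple0 /= eqxx.
have [iC | iC] := boolP (i \in C); last first.
  rewrite !notinC // big1 ?add0r => [|j _].
    by rewrite (negPf (contraNneq _ iC)) ?mul0r // => ->.
  by rewrite mxE (negPf iC) mul0r.
rewrite walksS // natrD natrM natr_sum (walksE _ r); congr (_ + _).
rewrite big_mkcond; apply: eq_bigr => j _; rewrite mxE iC.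
by case: (A i j); rewrite ?mul1r ?mul0r.
Qed.

Lemma is_rational_closed_words B S C :
  (forall j l, B (j, true) l = B (j, false) l && (l != j)) ->
  (forall j, B (j, false) j) ->
  is_rational (fun n => (closed_words B S C n)%:R : R).
Proof.
move=> Bt Bf; move: {2}#|S| (leqnn #|S|) => c; elim: c S => [|c IHc] S.
  rewrite leqn0 cards_eq0 => /eqP->.
  apply: eq_is_rational (is_rational_sum_sorted (fun j => B (j, false)) C) => n.
  congr (_%:R); apply: eq_sum_sorted => b _ _.
  have -> : marks set0 b = map (fun j => (j, false)) b.
    by elim: b => //= j b ->; rewrite inE.
  by rewrite words_map.
have [-> _ | [j jS] leS] := set_0Vmem S; first by apply: IHc; rewrite cards0.
have /IHc ratD : (#|S :\ j| <= c)%N by rewrite -ltnS (leq_trans _ leS) // (cardsD1 j S) jS.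
have jD : j \notin S :\ j by rewrite !inE eqxx.
rewrite -(setD1K jS); have [jC | jC] := boolP (j \in C); last first.
  by apply: eq_is_rational ratD => n; rewrite closed_words_unmarked.
apply: (is_rational_from (N := 1)) (is_rationalB ratD (is_rational_shift ratD)).
move=> [] // n _; rewrite -(closed_words_mark n (Bt j) (Bf j) jC jD) natrD.
by rewrite addrK.
Qed.

Definition surj_words B S n : nat :=
  \sum_(b : n.-tuple 'I_K | sorted (@ord_le K) b && [forall j, j \in b])
    words B n (marks S b) [::] b.

(** Words with letters in [C] are classified by their exact set of letters [D]. By strong induction
    on [#|C|] the proper subsets [D] can be subtracted; the case [C = setT] is the claim. *)
Lemma is_rational_surj_words B S :
  (forall j l, B (j, true) l = B (j, false) l && (l != j)) ->
  (forall j, B (j, false) j) ->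
  is_rational (fun n => (surj_words B S n)%:R : R).
Proof.
move=> Bt Bf; pose N D n := (\sum_(b : n.-tuple 'I_K | sorted (@ord_le K) b &&
  ([set j in b] == D)) words B n (marks S b) [::] b)%N.
suff ratN C : is_rational (fun n => (N C n)%:R : R).
  apply: eq_is_rational (ratN setT) => n; congr (_%:R).
  apply: eq_bigl => b; congr (_ && _).
  apply/eqP/forallP => [bT j | bT]; first by have := in_setT j; rewrite -bT inE.
  by apply/setP => j; rewrite in_setT in_set; exact: bT.
have [c] := ubnP #|C|; elim: c C => // c IHc C leC.
have ratT : is_rational (fun n => \sum_(D : {set 'I_K} | D \proper C) (N D n)%:R : R).
  apply: is_rational_sum => D /proper_card ltD.
  by apply: IHc; apply: leq_trans ltD _.
apply: eq_is_rational (is_rationalB (is_rational_closed_words S C Bt Bf) ratT) => n.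
apply/eqP; rewrite subr_eq -natr_sum -natrD; apply/eqP; congr (_%:R).
rewrite /closed_words /sum_sorted.
rewrite (partition_big (fun b : n.-tuple 'I_K => [set j in b])
           (fun D => D \subset C)) /=; last first.
  by move=> b /andP[_ /allP bC]; apply/subsetP => j; rewrite inE => /bC.
rewrite (bigD1 C) //=; congr (_ + _)%N.
  apply: eq_bigl => b; rewrite -andbA; congr (_ && _).
  apply: andb_idl => /eqP<-; apply/allP => j jb; exact: etrans (in_set _ _) jb.
apply: eq_big => [D | D DC]; first by rewrite properEneq andbC.
apply: eq_bigl => b; rewrite -andbA; congr (_ && _).
apply: andb_idl => /eqP bD; apply/allP => j jb.
apply: (subsetP (proj1 (andP DC))); rewrite -bD; exact: etrans (in_set _ _) jb.
Qed.

End RationalWords.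

(** * Permutations increasing on blocks *)

Section Lexicographic.
Variables (K n : nat) (w : 'I_n -> 'I_K).
Implicit Types u v : 'I_n.

(** Values are compared first by the block that holds them, then by size: the order in which a
    permutation increasing on blocks lists its values. *)
Definition lex_le u v := (w u < w v)%N || ((w u == w v) && (u <= v)%N).

Lemma lex_le_total : total lex_le.
Proof.
move=> u v; rewrite /lex_le -!val_eqE /=.
by case: (ltngtP (w u) (w v)) => //= _; exact: leq_total.
Qed.

Lemma lex_le_trans : transitive lex_le.
Proof.
move=> v u x /orP[lt1 | /andP[/eqP e1 le1]] /orP[lt2 | /andP[/eqP e2 le2]].
- by apply/orP; left; exact: ltn_trans lt2.
- by apply/orP; left; rewrite -e2.
- by apply/orP; left; rewrite e1.
- by apply/orP; right; rewrite e1 e2 eqxx (leq_trans le1).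
Qed.

Lemma lex_le_anti : antisymmetric lex_le.
Proof.
move=> u v /andP[].
case/orP=> [lt1 | /andP[/eqP e1 le1]] /orP[lt2 | /andP[/eqP e2 le2]].
- by have := ltn_trans lt1 lt2; rewrite ltnn.
- by rewrite e2 ltnn in lt1.
- by rewrite e1 ltnn in lt2.
- by apply/val_inj/anti_leq; rewrite le1.
Qed.

End Lexicographic.

Section BlockPermutations.
Variables (K n : nat) (b : n.-tuple 'I_K).
Hypothesis sorted_b : sorted (@ord_le K) b.
Implicit Types (i j u v : 'I_n) (p : {perm 'I_n}).

Lemma block_mono i j : (i <= j)%N -> (tnth b i <= tnth b j)%N.
Proof.
move=> le_ij; have x0 := tnth b i; rewrite !(tnth_nth x0).
apply: (sorted_leq_nth (@ord_le_trans K) (fun=> leqnn _)) => //.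
  by rewrite inE size_tuple.
by rewrite inE size_tuple.
Qed.

Definition block_incr p :=
  [forall i : 'I_n, forall j : 'I_n, ((i < j)%N && (tnth b i == tnth b j)) ==> (p i < p j)%N].

Lemma block_incrP p : reflect
  (forall i j, (i < j)%N -> tnth b i = tnth b j -> (p i < p j)%N) (block_incr p).
Proof.
apply: (iffP forallP) => [H i j lt_ij /eqP bij | H i].
  by have /forallP/(_ j) := H i; rewrite lt_ij bij.
by apply/forallP => j; apply/implyP => /andP[lt_ij /eqP]; exact: H.
Qed.

Definition word_of p : n.-tuple 'I_K := [tuple tnth b ((p^-1)%g v) | v < n].

Lemma word_of_perm p : perm_eq (word_of p) b.
Proof. by apply/tuple_permP; exists (p^-1)%g. Qed.

Lemma tnth_word_of p i : tnth (word_of p) (p i) = tnth b i.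
Proof. by rewrite tnth_mktuple permK. Qed.

(** The one-line word of [p] is thus the sort of all values for an order that depends only on
    [word_of p], which gives the injectivity of [word_of]. *)
Lemma block_incr_sorted p : block_incr p ->
  sorted (lex_le (tnth (word_of p))) [seq p i | i <- enum 'I_n].
Proof.
move=> /block_incrP incr; rewrite sorted_map; apply: pairwise_sorted.
have : pairwise ltn (map val (enum 'I_n)).
  by rewrite val_enum_ord -(sorted_pairwise ltn_trans) iota_ltn_sorted.
rewrite pairwise_map; apply: sub_pairwise => i j /= lt_ij.
rewrite /lex_le !tnth_word_of.
have := block_mono (ltnW lt_ij); rewrite leq_eqVlt => /predU1P[/val_inj bij | -> //].
by rewrite bij eqxx ltnn /= ltnW // incr.
Qed.

Lemma word_of_inj p q : block_incr p -> block_incr q -> word_of p = word_of q -> p = q.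
Proof.
move=> /block_incr_sorted sp /block_incr_sorted sq wpq; rewrite wpq in sp.
suff pq : [seq p i | i <- enum 'I_n] = [seq q i | i <- enum 'I_n].
  by apply/permP => i; have /eq_in_map -> := pq; rewrite ?mem_enum.
have perm_enum (r : {perm 'I_n}) : perm_eq [seq r i | i <- enum 'I_n] (enum 'I_n).
  apply: uniq_perm; rewrite ?(map_inj_uniq perm_inj) ?enum_uniq // => i.
  by rewrite mem_enum; apply/mapP; exists (r^-1 i)%g; rewrite ?mem_enum ?permKV.
apply: (sorted_eq (@lex_le_trans _ _ _) (@lex_le_anti _ _ _) sp sq).
by rewrite (perm_trans (perm_enum p)) // perm_sym.
Qed.

(** Let [p] list the values in lexicographic order for [w]. The letters of [w] met along the way are
    sorted, hence spell [b], so [p] maps each block onto the values carrying its letter. *)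
Lemma word_of_surj (w : n.-tuple 'I_K) : perm_eq w b ->
  exists2 p, block_incr p & word_of p = w.
Proof.
move=> wb; pose s := sort (lex_le (tnth w)) (enum 'I_n).
have sz_s : size s == n by rewrite size_sort size_enum_ord.
have ss : sorted (lex_le (tnth w)) s by exact: sort_sorted (@lex_le_total _ _ _) _.
have tinj : injective (tnth (Tuple sz_s)).
  by apply/tuple_uniqP; rewrite /= sort_uniq enum_uniq.
pose p := perm tinj.
have ws : [tuple tnth w (p i) | i < n] = b.
  apply: val_inj; apply: (sorted_eq (@ord_le_trans K) (@ord_le_anti K)) => //.
    have -> : val [tuple tnth w (p i) | i < n] = map (tnth w) s.
      have sE : s = map (tnth (Tuple sz_s)) (enum 'I_n) by rewrite map_tnth_enum.
      rewrite [X in map _ X]sE -map_comp /=.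
      by apply: eq_map => i /=; rewrite permE.
    rewrite sorted_map; apply: sub_sorted ss => u v; rewrite /lex_le /ord_le /=.
    by case/orP => [/ltnW // | /andP[/eqP-> _]].
  apply: perm_trans wb; apply/tuple_permP; by exists p.
have wE i : tnth w (p i) = tnth b i by rewrite -ws tnth_mktuple.
exists p; last first.
  by apply: eq_from_tnth => v; rewrite tnth_mktuple -wE permKV.
apply/block_incrP => i j lt_ij bij.
have := sorted_ltn_nth (@lex_le_trans _ _ _) i ss.
move=> /(_ i j); rewrite !inE (eqP sz_s) !ltn_ord => /(_ isT isT lt_ij).
have sE (k : 'I_n) : nth i s k = p k by rewrite permE (tnth_nth i).
rewrite !sE /lex_le !wE bij ltnn eqxx /= leq_eqVlt => /predU1P[|//].
by move=> /val_inj/perm_inj eij; rewrite eij ltnn in lt_ij.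
Qed.

Variable sg : {ffun 'I_K -> bool}.

(* As pi increases on the block [l], its values all lie above the diagonal as
   soon as none of them falls in an earlier block and the first position of [l]
   is not a fixed point; dually below the diagonal, with the last position. *)
Definition row_rel (jm : 'I_K * bool) (l : 'I_K) : bool :=
  (if sg l then (l <= jm.1)%N else (jm.1 <= l)%N) && ~~ (jm.2 && (l == jm.1)).

Definition block_mark v : bool :=
  if sg (tnth b v) then [forall i : 'I_n, (tnth b i == tnth b v) ==> (v <= i)%N]
  else [forall i : 'I_n, (tnth b i == tnth b v) ==> (i <= v)%N].

Definition block_sign p :=
  [forall i : 'I_n, if sg (tnth b i) then (i < p i)%N else (p i < i)%N].

Lemma block_signP p : block_incr p ->
  block_sign p = [forall i, row_rel (tnth b (p i), block_mark (p i)) (tnth b i)].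
Proof.
move=> /block_incrP incr; apply/forallP/forallP => [sgn i | row i].
  have := sgn i; rewrite /row_rel /=; case: ifP => sgi lt_i.
    rewrite block_mono ?(ltnW lt_i) //=; apply/negP => /andP[mk /eqP bi].
    move: mk; rewrite /block_mark -bi sgi => /forallP/(_ i).
    by rewrite eqxx leqNgt lt_i.
  rewrite block_mono ?(ltnW lt_i) //=; apply/negP => /andP[mk /eqP bi].
  move: mk; rewrite /block_mark -bi sgi => /forallP/(_ i).
  by rewrite eqxx leqNgt lt_i.
case: ifP => sgi.
  (* Above the diagonal the induction runs over positions from the left. *)
  have [m] := ubnP (val i); elim: m i sgi => // m IHm i sgi lt_im.
  rewrite ltnNge; apply/negP => le_pi.
  have := row i; rewrite /row_rel /= sgi => /andP[le_b].
  have bpi : tnth b i = tnth b (p i).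
    by apply/val_inj/anti_leq; rewrite le_b block_mono.
  rewrite bpi eqxx andbT /block_mark -bpi sgi.
  (* If [p i = i], then [i] is unmarked, hence not first in its block; by induction the position
     before it has a value at least [i], against monotonicity. If [p i < i], monotonicity gives
     [p (p i) < p i] and induction the opposite. *)
  move: le_pi; rewrite leq_eqVlt => /predU1P[/val_inj pi | lt_pi] unmk.
    case/forallPn: unmk => i1; rewrite negb_imply pi -ltnNge => /andP[/eqP bi1 lt_i1].
    have lt_i' : (i.-1 < n)%N by rewrite (leq_ltn_trans (leq_pred i)).
    pose i' := Ordinal lt_i'.
    have lt_i'i : (i' < i)%N by rewrite /= prednK // (leq_ltn_trans _ lt_i1).
    have bi' : tnth b i' = tnth b i.
      apply/val_inj/anti_leq; rewrite block_mono ?(ltnW lt_i'i) //= -bi1.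
      by rewrite block_mono //= -ltnS prednK // (leq_ltn_trans _ lt_i1).
    have : (i' < p i')%N.
      by apply: IHm; rewrite ?bi' // -ltnS (leq_trans _ lt_im) // ltnS.
    have := incr _ _ lt_i'i bi'; rewrite pi /=; lia.
  have := incr _ _ lt_pi (esym bpi).
  have : (p i < p (p i))%N.
    by apply: IHm; rewrite -?bpi // -ltnS (leq_trans _ lt_im) // ltnS.
  by move=> /ltn_trans lt /lt; rewrite ltnn.
(* The mirror argument, from the right and with last positions. *)
have [m] := ubnP (n - i)%N; elim: m i sgi => // m IHm i sgi lt_im.
rewrite ltnNge; apply/negP => le_pi.
have := row i; rewrite /row_rel /= sgi => /andP[le_b].
have bpi : tnth b i = tnth b (p i).
  by apply/val_inj/anti_leq; rewrite le_b block_mono.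
rewrite bpi eqxx andbT /block_mark -bpi sgi.
move: le_pi; rewrite leq_eqVlt => /predU1P[/val_inj pi | lt_pi] unmk.
  case/forallPn: unmk => i1; rewrite negb_imply -pi -ltnNge => /andP[/eqP bi1 lt_i1].
  have lt_i' : (i.+1 < n)%N by rewrite (leq_ltn_trans lt_i1).
  pose i' := Ordinal lt_i'.
  have lt_ii' : (i < i')%N by [].
  have bi' : tnth b i = tnth b i'.
    by apply/val_inj/anti_leq; rewrite block_mono //= -bi1 block_mono.
  have : (p i' < i')%N.
    by apply: IHm; rewrite -?bi' //=; lia.
  have := incr _ _ lt_ii' bi'; rewrite -pi /=; lia.
have := incr _ _ lt_pi bpi.
have : (p (p i) < p i)%N.
  by apply: IHm; rewrite -?bpi //; have := ltn_ord (p i); lia.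
by move=> /ltn_trans lt /lt; rewrite ltnn.
Qed.

(** [marks] always marks the last row of a block, [block_mark] the first or the last according to
    the sign. Either way each nonempty block has exactly one mark, so the rows agree as
    multisets. *)
Lemma perm_block_marks :
  perm_eq [tuple (tnth b v, block_mark v) | v < n] (marks setT b).
Proof.
apply: perm_marked => [|j].
  rewrite map_marks -[X in perm_eq _ X](map_tnth_enum b) /= -map_comp.
  exact: perm_refl.
rewrite count_marks inE /= count_map.
have -> : count (preim (fun v => (tnth b v, block_mark v)) (pred1 (j, true)))
    (enum 'I_n) = #|[pred v | (tnth b v == j) && block_mark v]|.
  rewrite -sum1_count -sum1_card big_enum_cond; apply: eq_bigl => v.
  by rewrite !inE /= xpair_eqE eqb_id.
have markP u v : tnth b u = j -> tnth b v = j -> block_mark u -> block_mark v -> u = v.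
  move=> bu bv; rewrite /block_mark bu bv.
  case: (sg j) => /forallP/(_ v) + /forallP/(_ u); rewrite bu bv eqxx /= => h1 h2.
    by apply/val_inj/anti_leq; rewrite h1.
  by apply/val_inj/anti_leq; rewrite h1 andbT.
have [jb | jb] := boolP (j \in b); last first.
  apply: eq_card0 => v; rewrite !inE; apply: contraNF jb => /andP[/eqP<- _].
  exact: mem_tnth.
have /tnthP[v0 /esym/eqP bv0] := jb.
suff [v /andP[/eqP bv mkv]] : exists v, (tnth b v == j) && block_mark v.
  rewrite -[RHS](card1 v); apply: eq_card => u; rewrite !inE.
  apply/andP/eqP => [[/eqP bu mku] | ->]; last by rewrite bv eqxx.
  exact: markP.
rewrite /block_mark; case sgj: (sg j).
  case: (@arg_minnP _ v0 (fun v => tnth b v == j) val bv0) => v bv minv.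
  exists v; rewrite bv (eqP bv) sgj; apply/forallP => i; apply/implyP.
  exact: minv.
case: (@arg_maxnP _ v0 (fun v => tnth b v == j) val bv0) => v bv maxv.
exists v; rewrite bv (eqP bv) sgj; apply/forallP => i; apply/implyP.
exact: maxv.
Qed.

(** [word_of] is a bijection from block-increasing permutations to rearrangements of [b], and
    [block_signP] translates the sign condition row by row. *)
Lemma card_block_perms :
  #|[set p | block_incr p && block_sign p]| =
  words row_rel n (marks setT b) [::] b.
Proof.
rewrite -(words_perml _ _ _ _ perm_block_marks) /words sum1_card.
rewrite -(card_in_imset (f := word_of)) => [|p q]; last first.
  by rewrite !inE => /andP[ip _] /andP[iq _]; exact: word_of_inj.
rewrite -[RHS]cardsE; congr #|pred_of_set _|; apply/setP => w.
have allE p : word_of p = w -> block_incr p -> block_sign p =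
    all2 row_rel [tuple (tnth b v, block_mark v) | v < n] w.
  move=> <- ip; rewrite block_signP // all2_tuple.
  apply/forallP/forallP => H i; last first.
    by have := H (p i); rewrite tnth_mktuple tnth_word_of.
  by have := H (p^-1 i)%g; rewrite permKV !tnth_mktuple.
rewrite [RHS]inE; apply/imsetP/andP => [[p] | [wb Bw]].
  rewrite inE => /andP[ip sp] wE; rewrite -(allE p) // {1}wE.
  by split; first exact: word_of_perm.
have [p ip wE] := word_of_surj wb.
by exists p; rewrite ?wE // inE ip (allE p).
Qed.

End BlockPermutations.

(** * Cuts of a permutation *)

Section Gaps.
Variable N : nat.
Implicit Types (k : 'I_N) (i j : 'I_N.+1).

Definition gap_lo k : 'I_N.+1 := widen_ord (leqnSn N) k.
Definition gap_hi k : 'I_N.+1 := lift ord0 k.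

Lemma gap_hiE k : gap_hi k = k.+1 :> nat. Proof. exact: lift0. Qed.

Lemma count_gaps (P : pred nat) : count P (iota 0 N) = (\sum_(k < N) P k)%N.
Proof. by rewrite -val_enum_ord count_map -sum1_count big_enum_cond big_mkcond. Qed.

Section SurjectiveTuples.
Variables (K : nat) (b : N.+1.-tuple 'I_K.+1).
Hypotheses (sorted_b : sorted (@ord_le K.+1) b) (surj_b : forall l : 'I_K.+1, l \in b).

(* [level] is junk ([0]) beyond [N]. *)
Definition level m : nat := nth ord0 b m.

Lemma tnth_level i : tnth b i = level i :> nat.
Proof. by rewrite (tnth_nth ord0). Qed.

Lemma level_mono m m' : (m <= m' <= N)%N -> (level m <= level m')%N.
Proof.
case/andP => le_m le_N.
apply: (sorted_leq_nth (@ord_le_trans K.+1) (fun=> leqnn _)) => //.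
  by rewrite inE size_tuple ltnS (leq_trans le_m).
by rewrite inE size_tuple ltnS.
Qed.

Lemma level_surj c : (c <= K)%N -> exists2 m, (m <= N)%N & level m = c.
Proof.
move=> le_c; have /tnthP[i /(congr1 val)/= e] := surj_b (inord c).
exists i; first by rewrite -ltnS.
by rewrite -tnth_level -e inordK.
Qed.

Lemma level_max m : (level m <= K)%N. Proof. by rewrite -ltnS; exact: ltn_ord. Qed.

Lemma level0 : level 0 = 0%N.
Proof.
have [m le_m m0] := level_surj (leq0n K).
by apply/eqP; rewrite -leqn0 -[leqRHS]m0 level_mono.
Qed.

Lemma levelN : level N = K.
Proof.
have [m le_m mK] := level_surj (leqnn K).
by apply/eqP; rewrite eqn_leq level_max -[leqLHS]mK level_mono ?le_m /=.
Qed.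

Lemma level_step m : (m < N)%N -> level m.+1 = level m \/ level m.+1 = (level m).+1.
Proof.
move=> lt_m; have le1 : (level m <= level m.+1)%N by rewrite level_mono ?leqnSn.
suff : (level m.+1 <= (level m).+1)%N by lia.
rewrite leqNgt; apply/negP => lt_l.
have [m' le_m' m'E] : exists2 m', (m' <= N)%N & level m' = (level m).+1.
  by apply: level_surj; have := level_max m.+1; lia.
have [le_mm' | lt_mm'] := leqP m' m.
  by have := @level_mono m' m; rewrite le_mm' (ltnW lt_m) => /(_ isT); lia.
by have := @level_mono m.+1 m'; rewrite lt_mm' le_m' => /(_ isT); lia.
Qed.

(** The level either stays, contributing [V c c = 0], or rises by one, and each rise from [c] to
    [c.+1] happens once. *)
Lemma sum_levels (V : nat -> nat -> nat) m : (forall c, V c c = 0%N) -> (m <= N)%N ->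
  (\sum_(k < m) V (level k) (level k.+1) = \sum_(c < level m) V c c.+1)%N.
Proof.
move=> V0; elim: m => [|m IHm] lt_m; first by rewrite level0 !big_ord0.
rewrite big_ord_recr IHm /= 1?ltnW //.
by case: (level_step lt_m) => ->; rewrite ?V0 ?addn0 // big_ord_recr.
Qed.

Lemma sum_gaps (V : 'I_K.+1 -> 'I_K.+1 -> nat) : (forall c, V c c = 0%N) ->
  (\sum_(k < N) V (tnth b (gap_lo k)) (tnth b (gap_hi k)) =
   \sum_(c < K) V (inord c) (inord c.+1))%N.
Proof.
move=> V0; have := @sum_levels (fun c c' => V (inord c) (inord c')) N (fun=> V0 _) (leqnn N).
rewrite levelN => <-; apply: eq_bigr => k _.
have -> : level k = tnth b (gap_lo k) by rewrite tnth_level.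
by rewrite -gap_hiE -tnth_level !inord_val.
Qed.

Definition cut_set := [set k | tnth b (gap_lo k) != tnth b (gap_hi k)].

Lemma in_cut_set k : (k \in cut_set) = (level k != level k.+1).
Proof. by rewrite inE -val_eqE /= !tnth_level gap_hiE. Qed.

(** The block number counts the cuts to the left, so [b] can be recovered from its cut set. This is
    [sum_levels] with [V] the indicator of inequality. *)
Lemma level_cut_set m : (m <= N)%N ->
  level m = (\sum_(k < N | k < m) (k \in cut_set))%N.
Proof.
move=> le_m; rewrite (big_ord_narrow le_m) /=.
transitivity (\sum_(c < level m) (c != c.+1 :> nat))%N.
  rewrite -[LHS]card_ord -sum1_card; apply: eq_bigr => c _.
  by rewrite neq_ltn ltnSn.
rewrite -(@sum_levels (fun c c' => c != c')) // => [|c]; last by rewrite eqxx.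
by apply: eq_bigr => k _; rewrite in_cut_set.
Qed.

Lemma card_cut_set : #|cut_set| = K.
Proof.
rewrite -[RHS]levelN level_cut_set // -sum1_card big_mkcond /=.
by apply: eq_big => [k | k _]; [rewrite ltn_ord | case: (k \in _)].
Qed.

End SurjectiveTuples.

Definition surj_sorted K (b : N.+1.-tuple 'I_K.+1) :=
  sorted (@ord_le K.+1) b && [forall l : 'I_K.+1, l \in b].

Lemma cut_set_inj K : {in @surj_sorted K &, injective (@cut_set K)}.
Proof.
move=> b b' /andP[sb /forallP surj_b] /andP[sb' /forallP surj_b'] eqU.
apply: eq_from_tnth => i; apply: val_inj; rewrite /= !tnth_level.
by rewrite !level_cut_set // -1?ltnS // eqU.
Qed.

(** Conversely, let the letter at a position be the number of elements of [U] to its left. *)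
Lemma cut_set_surj K (U : {set 'I_N}) : #|U| = K ->
  exists2 b : N.+1.-tuple 'I_K.+1, surj_sorted b & cut_set b = U.
Proof.
move=> cardU; pose h m := #|[set k in U | k < m]%N|.
have hmono m m' : (m <= m')%N -> (h m <= h m')%N.
  move=> le_m; apply/subset_leq_card/subsetP => k; rewrite !inE => /andP[-> lt_k].
  exact: leq_trans le_m.
have hle m : (h m <= K)%N.
  by rewrite -cardU; apply/subset_leq_card/subsetP => k; rewrite inE => /andP[].
have hS (k : 'I_N) : h k.+1 = ((k \in U) + h k)%N.
  rewrite /h (cardsD1 k) !inE ltnSn andbT; congr (_ + _)%N.
  by apply: eq_card => u; rewrite !inE ltnS ltn_neqAle andbCA.
have h0 : h 0 = 0%N by apply: eq_card0 => k; rewrite !inE ltn0 andbF.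
have hN : h N = K by rewrite -cardU; apply: eq_card => k; rewrite !inE ltn_ord andbT.
pose b := [tuple (inord (h i) : 'I_K.+1) | i < N.+1].
have bE (i : 'I_N.+1) : tnth b i = h i :> nat by rewrite tnth_mktuple inordK // ltnS.
exists b; last first.
  apply/setP => k; rewrite inE -val_eqE /= !bE gap_hiE hS /=.
  by case: (k \in U); rewrite ?add0n ?eqxx // neq_ltn ltnSn.
apply/andP; split.
  rewrite /b /= sorted_map; apply: pairwise_sorted.
  have : pairwise ltn (map val (enum 'I_N.+1)).
    by rewrite val_enum_ord -(sorted_pairwise ltn_trans) iota_ltn_sorted.
  rewrite pairwise_map; apply: sub_pairwise => i j /= lt_ij.
  by rewrite /ord_le /= !inordK ?ltnS // hmono // ltnW.
apply/forallP => l.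
suff /(_ N (leqnn N)) : forall m, (m <= N)%N -> (l <= h m)%N -> l \in b.
  by rewrite hN -ltnS ltn_ord; apply.
elim=> [|m IHm] lt_m; first by rewrite h0 leqn0 => /eqP l0;
  apply/tnthP; exists ord0; apply: val_inj; rewrite /= bE h0.
have [le_l _ | lt_l le_l] := leqP l (h m); first exact: IHm (ltnW lt_m) le_l.
apply/tnthP; exists (gap_hi (Ordinal lt_m)); apply: val_inj; rewrite /= bE gap_hiE.
move: le_l; rewrite (hS (Ordinal lt_m)) /=; case: (_ \in U) => /=; lia.
Qed.

(** Beyond [C], there are [K - #|C|] cuts to choose among [N - #|C|] gaps. The test guards against
    truncated subtraction, which would give the binomial 1 when [K < #|C|]. *)
Lemma card_surj_sorted K (C : {set 'I_N}) :
  #|[set b : N.+1.-tuple 'I_K.+1 | surj_sorted b && (C \subset cut_set b)]| =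
  if (#|C| <= K)%N then 'C(N - #|C|, K - #|C|) else 0%N.
Proof.
have card_leN (A : {set 'I_N}) : (#|A| <= N)%N by rewrite -[leqRHS](card_ord N) max_card.
have le_C := card_leN C.
have [lt_NK | le_KN] := ltnP N K.
  rewrite eq_card0 => [|b]; first by rewrite bin_small ?if_same // ltn_sub2r //; lia.
  rewrite !inE; apply/negP => /andP[/andP[sb /forallP surj_b] _].
  by have := card_leN (cut_set b); rewrite card_cut_set // leqNgt lt_NK.
rewrite -(card_in_imset (f := fun b => ~: @cut_set K b)) => [|b b']; last first.
  rewrite !inE => /andP[sb _] /andP[sb' _] /setC_inj; exact: cut_set_inj.
(* Passing to complements turns cut sets that contain [C] into subsets of [~: C] of size [N - K]. *)
transitivity #|[set A : {set 'I_N} | A \subset ~: C & #|A| == (N - K)%N]|.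
  apply: eq_card => A; rewrite inE; apply/imsetP/andP => [[b] | [AC /eqP cA]].
    rewrite inE => /andP[/andP[sb /forallP surj_b] Cb] ->; rewrite setCS; split=> //.
    by rewrite cardsCs setCK card_ord card_cut_set.
  have [|b sb bA] := @cut_set_surj K (~: A).
    by rewrite cardsCs setCK card_ord cA subKn.
  by exists b; rewrite ?bA ?setCK // inE sb bA -setCS setCK.
rewrite cards_draws cardsCs setCK card_ord; case: leqP => [le_CK | lt_KC].
  by rewrite -bin_sub ?leq_sub2l //; congr 'C(_, _); lia.
by rewrite bin_small //; lia.
Qed.

Definition exceeds (p : {perm 'I_N.+1}) i := (i < p i)%N.
Definition gap_des (p : {perm 'I_N.+1}) k := (p (gap_hi k) < p (gap_lo k))%N.
Definition gap_asc p k := ~~ exceeds p (gap_lo k) && exceeds p (gap_hi k).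
Definition gap_xdes p k := exceeds p (gap_lo k) && ~~ exceeds p (gap_hi k).
(** The compulsory cuts. Sign changes from above to below the diagonal need no separate mention,
    being descents by [gap_xdes_des]. *)
Definition cuts p := [set k | gap_des p k || gap_asc p k].

Lemma gap_xdes_des p k : gap_xdes p k -> gap_des p k.
Proof.
rewrite /gap_xdes /exceeds -leqNgt gap_hiE => /andP[lt_lo le_hi].
rewrite /gap_des ltn_neqAle (leq_trans le_hi lt_lo) andbT.
by apply: contraTneq le_hi => /val_inj/perm_inj/(congr1 val); rewrite /= /bump /=; lia.
Qed.

Lemma gap_asc_ndes p k : gap_asc p k -> ~~ gap_des p k.
Proof.
rewrite /gap_asc /exceeds /gap_des gap_hiE -leqNgt => /andP[/= le_lo lt_hi].
rewrite -leqNgt; lia.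
Qed.

Lemma card_cuts p : #|cuts p| = (\sum_(k < N) gap_des p k + \sum_(k < N) gap_asc p k)%N.
Proof.
rewrite -sum1_card big_mkcond -big_split; apply: eq_bigr => k _ /=.
rewrite inE; case: (boolP (gap_asc p k)) => [/gap_asc_ndes/negPf-> // | _].
by rewrite orbF addn0; case: ifP.
Qed.

(** Upward and downward sign changes alternate, so their numbers differ by at most one, and each
    downward change is a descent. *)
Lemma sum_gap_asc_le p :
  (\sum_(k < N) gap_asc p k <= (\sum_(k < N) gap_des p k).+1)%N.
Proof.
pose s m := exceeds p (inord m).
have telescope m : (m <= N)%N ->
    (\sum_(k < m) (~~ s k && s k.+1) + s 0%N = \sum_(k < m) (s k && ~~ s k.+1) + s m)%N.
  elim: m => [|m IHm] lt_m; first by rewrite !big_ord0.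
  have := IHm (ltnW lt_m); rewrite !big_ord_recr /=.
  by case: (s m); case: (s m.+1) => /=; lia.
have sE k : s k = exceeds p (gap_lo k) /\ s k.+1 = exceeds p (gap_hi k).
  rewrite /s -gap_hiE inord_val; split=> //; congr exceeds; apply: val_inj.
  by rewrite /= inordK // ltnS ltnW.
have le_xdes : (\sum_(k < N) (s k && ~~ s k.+1) <= \sum_(k < N) gap_des p k)%N.
  apply: leq_sum => k _; have [-> ->] := sE k; rewrite -/(gap_xdes p k).
  by case: (boolP (gap_xdes p k)) => // /gap_xdes_des->.
have := telescope N (leqnn N).
have -> : (\sum_(k < N) (~~ s k && s k.+1) = \sum_(k < N) gap_asc p k)%N.
  by apply: eq_bigr => k _; have [-> ->] := sE k.
have := leq_b1 (s N); lia.
Qed.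

End Gaps.

(** * Block divisions of a fixed permutation *)

Section BlocksOfPermutation.
Variables (N K : nat) (b : N.+1.-tuple 'I_K.+1) (p : {perm 'I_N.+1}).
Hypothesis bP : surj_sorted b.
Implicit Types (k : 'I_N) (i j : 'I_N.+1).

Let sorted_b : sorted (@ord_le K.+1) b. Proof. by case/andP: bP. Qed.
Let surj_b (l : 'I_K.+1) : l \in b.
Proof. by case/andP: bP => _ /forallP. Qed.

Definition block_signs : {ffun 'I_K.+1 -> bool} :=
  [ffun l => [exists i, (tnth b i == l) && exceeds p i]].

(** Between neighbours of one block there is no compulsory cut, hence no descent and no upward sign
    change; a downward one would be a descent. *)
Lemma block_const i j : cuts p \subset cut_set b -> (i <= j)%N ->
  tnth b i = tnth b j -> (p i <= p j)%N && (exceeds p i == exceeds p j).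
Proof.
move=> /subsetP cutb; have [m] := ubnP (nat_of_ord j); elim: m j => // m IHm j lt_jm.
rewrite leq_eqVlt => /predU1P[/val_inj-> _|lt_ij bij]; first by rewrite leqnn eqxx.
have lt_k : (j.-1 < N)%N by have := ltn_ord j; lia.
pose k := Ordinal lt_k.
have hiE : gap_hi k = j by apply: ord_inj; rewrite gap_hiE /=; lia.
have le_i_lo : (i <= gap_lo k)%N by rewrite /=; lia.
have b_lo : tnth b (gap_lo k) = tnth b j.
  apply/val_inj/anti_leq; rewrite block_mono //=; last by lia.
  by rewrite -bij block_mono.
have /IHm-/(_ le_i_lo) : (gap_lo k < m)%N by rewrite /=; lia.
rewrite b_lo => /(_ bij)/andP[le_p /eqP->].
have : k \notin cuts p.
  by apply/negP => /cutb; rewrite inE b_lo hiE eqxx.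
rewrite inE negb_or => /andP[ndes].
have := contra (@gap_xdes_des _ p k) ndes.
rewrite /gap_xdes /gap_asc hiE; move: ndes; rewrite /gap_des hiE -leqNgt => le_lo.
rewrite (leq_trans le_p le_lo) /=.
by case: (exceeds p (gap_lo k)); case: (exceeds p j).
Qed.

Lemma block_signsE i : cuts p \subset cut_set b ->
  block_signs (tnth b i) = exceeds p i.
Proof.
move=> cutb; rewrite ffunE; apply/existsP/idP => [[j /andP[/eqP bj]] | ex_i].
  have [le_ij | /ltnW le_ji] := leqP i j.
    by have /andP[_ /eqP->] := block_const cutb le_ij (esym bj).
  by have /andP[_ /eqP->] := block_const cutb le_ji bj.
by exists i; rewrite eqxx.
Qed.

(** For given [p] and [b] at most one sign vector is possible, so a sum over [sg] reduces to one
    term. *)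
Lemma block_incr_sign (sg : {ffun 'I_K.+1 -> bool}) :
  block_incr b p && block_sign b sg p =
  [&& derangement p, cuts p \subset cut_set b & sg == block_signs].
Proof.
apply/andP/and3P => [[/block_incrP incr /forallP sgn] | [/forallP der cutb /eqP->]].
  have sgE i : sg (tnth b i) = exceeds p i.
    have := sgn i; rewrite /exceeds; case: ifP => _ lt_i; first by rewrite lt_i.
    by rewrite ltnNge ltnW.
  split.
  - apply/forallP => i; have := sgn i; apply: contraTneq => ->.
    by rewrite if_same ltnn.
  - apply/subsetP => k; rewrite !inE; apply: contraTneq => bk.
    have := incr _ _ _ bk; rewrite gap_hiE ltnSn => /(_ isT) lt_p.
    rewrite /gap_des /gap_asc -!sgE bk andNb orbF -leqNgt.
    exact: ltnW.
  - apply/eqP/ffunP => l; have /tnthP[i ->] := surj_b l.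
    rewrite ffunE sgE; apply/idP/existsP => [ex_i | [j /andP[/eqP bj]]].
      by exists i; rewrite eqxx.
    by rewrite -!sgE bj.
split.
  apply/block_incrP => i j lt_ij bij.
  have /andP[le_p _] := block_const cutb (ltnW lt_ij) bij.
  rewrite ltn_neqAle le_p andbT; apply: contraTneq lt_ij => /val_inj/perm_inj->.
  by rewrite ltnn.
apply/forallP => i; rewrite block_signsE // /exceeds; case: ltnP => // le_i.
by rewrite ltn_neqAle le_i andbT; exact: der.
Qed.

(** Signs change only across cuts, so sign-change statistics of [p] can be read off the sign vector
    of the blocks. This is applied to [xdes] and [asc]. *)
Lemma sum_block_signs (V : rel bool) : (forall s, V s s = false) ->
  cuts p \subset cut_set b ->
  (\sum_(c < K) V (block_signs (inord c)) (block_signs (inord c.+1)) =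
   \sum_(k < N) V (exceeds p (gap_lo k)) (exceeds p (gap_hi k)))%N.
Proof.
move=> V0 cutb.
rewrite -(sum_gaps sorted_b surj_b (V := fun l l' => V (block_signs l) (block_signs l'))).
  by apply: eq_bigr => k _; rewrite !block_signsE.
by move=> l; rewrite V0.
Qed.

End BlocksOfPermutation.

(** For a derangement, the sign changes of [pi_i - i] from negative to positive: the compulsory cuts
    that are not descents. *)
Definition asc n (p : {perm 'I_n}) : nat :=
  count (fun k => (nth 0 (pw p) k <= k) && (k.+1 < nth 0 (pw p) k.+1))%N (iota 0 n.-1).

Section Statistics.
Variables (N : nat) (p : {perm 'I_N.+1}).

Lemma nth_pw (i : 'I_N.+1) : nth 0%N (pw p) i = p i.
Proof. by rewrite (nth_map i) ?size_enum_ord // nth_ord_enum. Qed.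

Lemma desE : des p = (\sum_(k < N) gap_des p k)%N.
Proof.
rewrite /des count_gaps; apply: eq_bigr => k _.
by rewrite /gap_des -(nth_pw (gap_lo k)) -(nth_pw (gap_hi k)) gap_hiE.
Qed.

Lemma ascE : asc p = (\sum_(k < N) gap_asc p k)%N.
Proof.
rewrite /asc count_gaps; apply: eq_bigr => k _.
by rewrite /gap_asc /exceeds -leqNgt -(nth_pw (gap_lo k)) -(nth_pw (gap_hi k)) gap_hiE.
Qed.

(** A crossing descent requires a value at most [k] at position [k.+1], [gap_xdes] one at most
    [k.+1]; they differ only at a fixed point. *)
Lemma xdesE : derangement p -> xdes p = (\sum_(k < N) gap_xdes p k)%N.
Proof.
move=> /forallP der; rewrite /xdes count_gaps; apply: eq_bigr => k _.
rewrite /gap_xdes /exceeds -leqNgt -(nth_pw (gap_lo k)); congr (nat_of_bool (_ && _)).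
have := der (gap_hi k); rewrite -val_eqE /= -(nth_pw (gap_hi k)) gap_hiE => ne.
by rewrite [RHS]leq_eqVlt (negPf ne) ltnS.
Qed.

Lemma asc_le_des : (asc p <= (des p).+1)%N.
Proof. by rewrite ascE desE sum_gap_asc_le. Qed.

Lemma card_cutsE : #|cuts p| = (des p + asc p)%N.
Proof. by rewrite card_cuts desE ascE. Qed.

End Statistics.

(** * Counting derangements *)

Definition sign_xdes K (sg : {ffun 'I_K.+1 -> bool}) : nat :=
  (\sum_(c < K) (sg (inord c) && ~~ sg (inord c.+1)))%N.

Definition sign_asc K (sg : {ffun 'I_K.+1 -> bool}) : nat :=
  (\sum_(c < K) (~~ sg (inord c) && sg (inord c.+1)))%N.

(** [K] counts the cuts, so there are [K.+1] blocks. *)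
Definition block_series K y n : {poly rat} :=
  \sum_(sg : {ffun 'I_K.+1 -> bool} | sign_asc sg == y)
    'X^(sign_xdes sg) * (surj_words (row_rel sg) setT n)%:R.

(** The refinement by [asc] fixes the number [d + y] of compulsory cuts. *)
Definition der_series y d n : {poly rat} :=
  if n is 0 then 0 else
  \sum_(p : {perm 'I_n} | [&& derangement p, asc p == y & des p == d]) 'X^(xdes p).

Lemma is_rational_block_series K y : is_rational (block_series K y).
Proof.
apply: is_rational_sum => sg _; apply: is_rationalZ; apply: is_rational_surj_words.
  by move=> j l; rewrite /row_rel /= andbT.
by move=> j; rewrite /row_rel /= andbT leqnn if_same.
Qed.

(** Double counting of triples of a sign vector, a permutation and a division: the left side fixes
    signs and division first, the right side the permutation. *)
Lemma block_seriesE K y N : block_series K y N.+1 =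
  \sum_(p : {perm 'I_N.+1} | derangement p && (asc p == y))
    (if #|cuts p| <= K then 'C(N - #|cuts p|, K - #|cuts p|) else 0)%N%:R * 'X^(xdes p).
Proof.
transitivity (\sum_(sg : {ffun 'I_K.+1 -> bool} | sign_asc sg == y)
  \sum_(p : {perm 'I_N.+1}) \sum_(b : N.+1.-tuple 'I_K.+1 | surj_sorted b)
   if block_incr b p && block_sign b sg p then 'X^(sign_xdes sg) else 0 : {poly rat}).
  apply: eq_bigr => sg _; rewrite exchange_big natr_sum mulr_sumr.
  apply: eq_bigr => b /andP[sb _]; rewrite -card_block_perms // -sum1_card.
  rewrite natr_sum mulr_sumr -big_mkcond; apply: eq_big => [p | p _]; first by rewrite inE.
  by rewrite mulr1.
rewrite exchange_big big_mkcond [RHS]big_mkcond; apply: eq_bigr => p _.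
rewrite exchange_big /= -card_surj_sorted.
rewrite (eq_bigr (fun b => if [&& derangement p, asc p == y & cuts p \subset cut_set b]
                           then 'X^(xdes p) else 0)) => [|b bP].
  have [/andP[-> ->] | nder] := boolP (derangement p && (asc p == y)); last first.
    by rewrite big1 // => b _; rewrite andbA (negPf nder).
  rewrite -big_mkcondr /= -sum1_card natr_sum mulr_suml.
  by apply: eq_big => [b | b _]; rewrite ?inE ?mul1r.
rewrite (eq_bigr (fun sg => if sg == block_signs b p then
   if derangement p && (cuts p \subset cut_set b) then 'X^(sign_xdes sg) else 0
   else 0)) => [|sg _]; last first.
  by rewrite (block_incr_sign _ bP) andbA; case: (sg == _); rewrite ?andbT ?andbF.
rewrite -big_mkcondr /= (andbC (asc p == y)) andbA.
have [/andP[der cutb] | ncut] := boolP (derangement p && _); last first.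
  by rewrite big1.
rewrite (_ : asc p = sign_asc (block_signs b p)); last first.
  by rewrite ascE -(sum_block_signs bP (V := fun s t => ~~ s && t)) // => -[].
rewrite (_ : xdes p = sign_xdes (block_signs b p)); last first.
  by rewrite xdesE // -(sum_block_signs bP (V := fun s t => s && ~~ t)) // => -[].
rewrite /=; case: ifP => [y_asc | ny].
  rewrite (big_pred1 (block_signs b p)) // => sg /=.
  by apply/andP/eqP => [[_ /eqP//] | ->].
rewrite big_pred0 // => sg; apply/negP => /andP[+ /eqP e].
by rewrite e ny.
Qed.

(** With [d + y] cuts in all, a derangement with [d'] descents has [d - d'] free cuts, and one with
    more than [d] descents has no division. *)
Lemma block_series_der y d n : (0 < n)%N ->
  block_series (d + y) y n =
  \sum_(d' < d.+1) 'C(n.-1 - (d' + y), d - d')%:R * der_series y d' n.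
Proof.
case: n => // N _; rewrite block_seriesE /=.
under [RHS]eq_bigr => d' _ do rewrite big_distrr /= big_mkcond /=.
rewrite exchange_big /= big_mkcond; apply: eq_bigr => p _.
case: (derangement p && (asc p == y)) / andP => [[der /eqP ap] | nder]; last first.
  rewrite big1 // => d' _; case: and3P => // -[der ap _].
  by case: nder.
rewrite card_cutsE ap leq_add2r subnDr.
case: leqP => [le_d | lt_d].
  rewrite (bigD1 (inord (des p))) //= inordK // der !eqxx /= big1 ?addr0 // => d' ne.
  by case: eqP => // e; rewrite e inord_val eqxx in ne.
rewrite mul0r big1 // => d' _; case: and3P => // -[_ _ /eqP e].
by have := ltn_ord d'; rewrite -e ltnS leqNgt lt_d.
Qed.

Lemma is_rational_der_series y d : is_rational (der_series y d).
Proof.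
have [m] := ubnP d; elim: m d => // m IHm d lt_dm.
have rat_sum : is_rational (fun n => \sum_(d' < d)
    'C(n.-1 - (d' + y), d - d')%:R * der_series y d' n).
  apply: is_rational_sum => d' _; apply: is_rational_bin.
  - by move=> j; rewrite -polyC_natr polyC_eq0 Num.Theory.pnatr_eq0.
  (* A permutation of size [n.+1] has only [n] gaps, so it cannot have [d' + y > n] compulsory
     cuts. *)
  - case=> // n le_n; rewrite /= big_pred0 // => p; apply/negP => /and3P[_ /eqP ap /eqP dp].
    have := max_card (cuts p); rewrite card_cutsE ap dp card_ord.
    by rewrite leqNgt le_n.
  - by apply: IHm; rewrite -ltnS (leq_trans _ lt_dm) // ltnS.
apply: (is_rational_from (N := 1))
  (is_rationalB (is_rational_block_series (d + y) y) rat_sum) => n n_gt0.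
rewrite block_series_der // big_ord_recr /= subnn bin0 mul1r.
by rewrite addrAC subrr add0r.
Qed.

Theorem theorem3p1 (m : nat) : rational_series (Fcoef m).
Proof.
suff : is_rational (Fcoef m) by [].
(* By [asc_le_des] only [y <= m + 1] occurs, so the sum over [y] is finite. *)
have rat_sum : is_rational (fun n => \sum_(y < m.+2) der_series y m n).
  by apply: is_rational_sum => y _; exact: is_rational_der_series.
(* The coefficients at sizes 0 and 1, set by convention in [Fcoef], are left out of the
   comparison. *)
apply: (is_rational_from (N := 2)) rat_sum => -[|[|n]] // _.
rewrite /Fcoef /=; under eq_bigr => y _ do rewrite big_mkcond.
rewrite exchange_big [RHS]big_mkcond; apply: eq_bigr => p _ /=.
case: andP => [[der /eqP dp] | nder]; last first.
  by rewrite big1 // => y _; case: and3P => // -[der _ dp]; case: nder.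
have lt_asc : (asc p < m.+2)%N by rewrite ltnS -dp asc_le_des.
rewrite (bigD1 (Ordinal lt_asc)) //= der dp !eqxx big1 ?addr0 // => y ne.
case: eqP => // e; case/eqP: ne; exact: val_inj.
Qed.
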